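(* On finite acyclic graphs (forests) both of the following problems can be solved in time linear in the size of the graph: (i) given an acyclic graph $G=(V,E)$ and a subset $D\subseteq V$, decide whether $D$ is an information dominating set of $G$; (ii) given an acyclic graph $G$, construct an information dominating set of $G$ of minimum cardinality.
   Context: Graphs are finite, simple and undirected. A binary opinion profile on $G=(V,E)$ is a vector $\mu=(\mu_v)_{v\in V}\in\{0,1\}^V$. Given $\mu$, a neighbor $w$ of a vertex $v$ is same-minded if $\mu_w=\mu_v$ and opposite-minded otherwise. The profile $\mu$ is valid (under the local majority rule) if for every vertex $v$ the number of same-minded neighbors of $v$ is greater than or equal to the number of its opposite-minded neighbors. A subset $D\subseteq V$ is an information dominating set (IDS) of $G$ if the opinions on $D$ suffice to determine those of all vertices under any valid opinion profile; equivalently, for any two different valid opinion profiles $\mu,\nu$ on $G$ there exists $v\in D$ with $\mu_v\neq\nu_v$. *)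

(* Defs.v *)
From mathcomp Require Import all_boot.

Set Implicit Arguments.
Unset Strict Implicit.
Unset Printing Implicit Defensive.

Section Graphs.
Variables (T : finType) (e : rel T).

Definition simple_graph : Prop := symmetric e /\ irreflexive e.

(* [cycle e [:: u; v]] only says that [u] and [v] are adjacent, so the graph
   cycles are the duplicate-free [e]-cycles with at least three vertices. *)
Definition acyclic : Prop :=
  forall c : seq T, cycle e c -> uniq c -> size c < 3.

Definition edges : {set {set T}} :=
  [set [set p.1; p.2] | p : T * T & e p.1 p.2].

Definition graph_size : nat := #|T| + #|edges|.

Definition same_minded (mu : {ffun T -> bool}) (v : T) : {set T} :=
  [set w | e v w & mu w == mu v].

Definition opposite_minded (mu : {ffun T -> bool}) (v : T) : {set T} :=
  [set w | e v w & mu w != mu v].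

Definition valid_profile (mu : {ffun T -> bool}) : bool :=
  [forall v, #|opposite_minded mu v| <= #|same_minded mu v|].

Definition IDS (D : {set T}) : bool :=
  [forall mu : {ffun T -> bool}, forall nu : {ffun T -> bool},
     [&& valid_profile mu, valid_profile nu & mu != nu] ==>
     [exists v in D, mu v != nu v]].

Definition minimum_IDS (D : {set T}) : Prop :=
  IDS D /\ forall D' : {set T}, IDS D' -> #|D| <= #|D'|.

End Graphs.

(* Machine model: a random access machine, programmed with structured control
   flow, having registers and arrays (both indexed by nat; a program mentions
   only finitely many of them, but array cells are addressed indirectly).  The
   cost is the uniform one: each elementary operation, comparison, memory
   access or branching costs one unit.  The only arithmetic operations are
   successor and predecessor, so that within [t] units of time every number is
   at most the largest number of the input and program plus [t]; hence in
   linear time all words have logarithmic length, and charging one unit per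
   operation hides no long-number arithmetic. *)

Inductive expr : Type :=
  | Cst of nat
  | Reg of nat
  | Get of nat & expr     (* [Get a i] is cell [i] of array [a] *)
  | Succ of expr
  | Pred of expr.

Inductive test : Type :=
  | TEq of expr & expr
  | TLt of expr & expr
  | TNot of test
  | TAnd of test & test.

Inductive cmd : Type :=
  | Skip
  | Assign of nat & expr            (* register := value *)
  | Store of nat & expr & expr      (* array[index] := value *)
  | Seq of cmd & cmd
  | If of test & cmd & cmd
  | While of test & cmd.

Record state : Type := State { reg : nat -> nat; mem : nat -> nat -> nat }.

Definition set_reg (s : state) (x k : nat) : state :=
  State (fun y => if y == x then k else reg s y) (mem s).

Definition set_mem (s : state) (a i k : nat) : state :=
  State (reg s)
    (fun b j => if (b == a) && (j == i) then k else mem s b j).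

Fixpoint eval (s : state) (x : expr) : nat :=
  match x with
  | Cst k => k
  | Reg y => reg s y
  | Get a i => mem s a (eval s i)
  | Succ y => (eval s y).+1
  | Pred y => (eval s y).-1
  end.

Fixpoint expr_cost (x : expr) : nat :=
  match x with
  | Cst _ | Reg _ => 1
  | Get _ y | Succ y | Pred y => (expr_cost y).+1
  end.

Fixpoint holds (s : state) (b : test) : bool :=
  match b with
  | TEq x y => eval s x == eval s y
  | TLt x y => eval s x < eval s y
  | TNot b => ~~ holds s b
  | TAnd b1 b2 => holds s b1 && holds s b2
  end.

Fixpoint test_cost (b : test) : nat :=
  match b with
  | TEq x y | TLt x y => (expr_cost x + expr_cost y).+1
  | TNot b => (test_cost b).+1
  | TAnd b1 b2 => (test_cost b1 + test_cost b2).+1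
  end.

(* [exec p s t s']: started in [s], the program [p] halts in [s'] after
   exactly [t] units of time. *)
Inductive exec : cmd -> state -> nat -> state -> Prop :=
  | ExecSkip s : exec Skip s 1 s
  | ExecAssign s x y :
      exec (Assign x y) s (expr_cost y).+1 (set_reg s x (eval s y))
  | ExecStore s a i y :
      exec (Store a i y) s (expr_cost i + expr_cost y).+1
        (set_mem s a (eval s i) (eval s y))
  | ExecSeq p q s t s' t' s'' :
      exec p s t s' -> exec q s' t' s'' -> exec (Seq p q) s (t + t') s''
  | ExecIf b p q s t s' :
      exec (if holds s b then p else q) s t s' ->
      exec (If b p q) s ((test_cost b).+1 + t) s'
  | ExecWhileStop b p s :
      ~~ holds s b -> exec (While b p) s (test_cost b).+1 s
  | ExecWhileStep b p s t s' t' s'' :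
      holds s b -> exec p s t s' -> exec (While b p) s' t' s'' ->
      exec (While b p) s ((test_cost b).+1 + t + t') s''.

Lemma exec_det p s t1 s1 t2 s2 :
  exec p s t1 s1 -> exec p s t2 s2 -> t1 = t2 /\ s1 = s2.
Proof.
move=> E1; elim: E1 t2 s2 => {p s t1 s1}.
- by move=> s t2 s2 E; inversion E.
- by move=> s x y t2 s2 E; inversion E.
- by move=> s a i y t2 s2 E; inversion E.
- move=> p q s t s' t' s'' _ IHp _ IHq t2 s2 E; inversion E; subst.
  match goal with H : exec p _ _ _ |- _ => have [-> ?] := IHp _ _ H end; subst.
  by match goal with H : exec q _ _ _ |- _ => have [-> ->] := IHq _ _ H end.
- move=> b p q s t s' _ IH t2 s2 E; inversion E; subst.
  by match goal with
     | H : exec (if _ then _ else _) _ _ _ |- _ => have [-> ->] := IH _ _ H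
     end.
- by move=> b p s /negPf nb t2 s2 E; inversion E; subst => //; congruence.
- move=> b p s t s' t' s'' hb _ IHp _ IHw t2 s2 E; inversion E; subst.
    by match goal with H : is_true (~~ _) |- _ => rewrite hb in H end.
  match goal with H : exec p _ _ _ |- _ => have [-> ?] := IHp _ _ H end; subst.
  by match goal with
     | H : exec (While b p) _ _ _ |- _ => have [-> ->] := IHw _ _ H
     end.
Qed.

Section Encoding.
Variable n : nat.

(* The order of the neighbours within each list is arbitrary. *)
Definition adjacency_lists (e : rel 'I_n) (adj : 'I_n -> seq 'I_n) : Prop :=
  forall v, uniq (adj v) /\ (forall w, (w \in adj v) = e v w).

(* Initial memory: register 0 holds the number [n] of vertices; array 1 is the
   concatenation of the adjacency lists of 0, ..., n-1, the list of [v]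
   occupying the cells from [offset v] to [offset v.+1] (excluded), where
   [offset] is array 0; array 2 is the characteristic vector of [D].
   Everything else is 0. *)
Definition input (adj : 'I_n -> seq 'I_n) (D : {set 'I_n}) : state :=
  State
    (fun x => if x == 0 then n else 0)
    (fun a => match a with
       | 0 => nth 0 (0 :: scanl addn 0 [seq size (adj v) | v <- enum 'I_n])
       | 1 => nth 0 (flatten [seq map val (adj v) | v <- enum 'I_n])
       | 2 => nth 0 [seq nat_of_bool (v \in D) | v <- enum 'I_n]
       | _ => fun=> 0
       end).

Definition output_bool (s : state) (b : bool) : Prop :=
  reg s 0 = nat_of_bool b.

Definition output_set (s : state) (D : {set 'I_n}) : Prop :=
  forall v : 'I_n, mem s 2 v = nat_of_bool (v \in D).

End Encoding.

(* [O(size)], with the additive constant needed for the empty graph. *)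
Definition runs_linear (c size : nat) (p : cmd) (s : state)
    (post : state -> Prop) : Prop :=
  exists t s', [/\ exec p s t s', t <= c * size.+1 & post s'].

(* Main.v *)
Require Import Defs.
From mathcomp Require Import all_boot zify.

Set Implicit Arguments.
Unset Strict Implicit.
Unset Printing Implicit Defensive.

(* In a forest every edge set is the disagreement set of a profile, and a profile
   is valid iff at most half of the edges at each vertex are disagreements.  So
   two valid profiles can differ exactly on S iff the edges leaving S can be
   2-coloured with at most deg(v)/2 edges of each colour at every v.  It follows
   that D is an information dominating set iff
   - D contains every vertex of even degree without leaf neighbours,
   - D meets the cluster (a vertex and its leaf neighbours) of every vertex that
     has a leaf neighbour, and
   - D meets every edge between vertices of odd degree without leaf neighbours.
   This is checked by two scans of the adjacency lists.  A minimum D consists of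
   the vertices of the first kind, one vertex for each cluster, and a greedy
   vertex cover found by removing vertices of degree 1 one after the other: when u
   is removed and neither u nor its remaining neighbour w is in D, w enters D.
   The removed partners u form a matching, which yields pairwise disjoint sets
   that every information dominating set meets, as many as D has elements. *)

(** * Information dominating sets of forests *)

Section Forests.
Variables (T : finType) (e : rel T).
Hypotheses (simple_e : simple_graph e) (acyclic_e : acyclic e).

Definition nbrs v : {set T} := [set w | e v w].
Definition degree v := #|nbrs v|.
Definition leaf v := degree v == 1.
Definition leaf_adjacent v := [exists w, e v w && leaf w].

Let e_sym : symmetric e. Proof. by case: simple_e. Qed.
Let e_irr : irreflexive e. Proof. by case: simple_e. Qed.

(** The path grows at its head [x]: one of the two or more neighbours of [x] in [A] differs from the
    second vertex of the path, and it lies off the path, since otherwise it would close a cycle. *)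
Lemma long_path (A : {set T}) (k : nat) :
  A != set0 -> (forall x, x \in A -> 1 < #|nbrs x :&: A|) ->
  exists x p, [/\ path e x p, uniq (x :: p), {subset x :: p <= A} & size p = k].
Proof.
move=> /set0Pn[x0 Ax0] Adeg; elim: k => [|k [x [p [pathp uniqp subp sizep]]]].
  by exists x0, [::]; split=> // y; rewrite inE => /eqP->.
have Ax : x \in A by apply: subp; rewrite inE eqxx.
suff [y [Ay exy yp]] : exists y, [/\ y \in A, e x y & y \notin x :: p].
  exists y, (x :: p); split.
  - by rewrite /= e_sym exy.
  - by rewrite cons_uniq yp.
  - by move=> z; rewrite inE => /predU1P[->|/subp].
  - by rewrite /= sizep.
(* For a one-vertex path [x1] is [x] itself, and excluding it is harmless. *)
pose x1 := head x p.
have /set0Pn[y] : (nbrs x :&: A) :\ x1 != set0.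
  by rewrite -card_gt0; have := cardsD1 x1 (nbrs x :&: A); have := Adeg x Ax; lia.
rewrite !inE => /and3P[yx1 exy Ay]; exists y; split=> //.
apply/negP; rewrite inE => /predU1P[yx|]; first by rewrite yx e_irr in exy.
case: p => [|z p] // in pathp uniqp x1 yx1 {subp sizep} *; rewrite inE (negPf yx1) /=.
move=> yp; case/splitPr: yp pathp uniqp => p1 p2 pathp uniqp.
have := acyclic_e (c := x :: z :: rcons p1 y); rewrite /= size_rcons /=.
move: pathp; rewrite /= cat_path /= => /and3P[-> pathp1 /andP[ey _]].
rewrite rcons_path last_rcons e_sym exy rcons_path pathp1 ey /= => /(_ isT).
move: uniqp; rewrite -cat_rcons /= mem_cat cat_uniq inE mem_cat => uniqp.
suff -> : (x \notin z :: rcons p1 y) && ((z \notin rcons p1 y) && uniq (rcons p1 y)).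
  by move/(_ isT).
by move: uniqp; rewrite !inE; do !case: (_ \in _); do !case: (uniq _); do !case: (_ == _).
Qed.

(** Otherwise there would be a path with [#|T|] edges and hence [#|T|.+1] distinct vertices. *)
Lemma exists_low_degree (A : {set T}) :
  A != set0 -> exists2 x, x \in A & #|nbrs x :&: A| <= 1.
Proof.
move=> A0; apply/exists_inP; apply: contraT; rewrite negb_exists_in => /forall_inP Adeg.
have [x Ax|x [p [_ uniqp _ sizep]]] := @long_path A #|T| A0.
  by rewrite ltnNge Adeg.
by have := max_card (mem (x :: p)); rewrite (card_uniqP uniqp) /= sizep ltnn.
Qed.

(** The vertices of [A] with a neighbour in [A] keep all these neighbours among themselves, so each
    would have at least two, contrary to [exists_low_degree]. *)
Lemma peeled_edgeless (A : {set T}) :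
  (forall x, x \in A -> #|nbrs x :&: A| != 1) ->
  forall x y, x \in A -> y \in A -> ~~ e x y.
Proof.
move=> Adeg x y Ax Ay; apply/negP => exy.
pose A' := [set z in A | nbrs z :&: A != set0].
have A'x : x \in A' by rewrite inE Ax; apply/set0Pn; exists y; rewrite !inE exy.
have [|z] := @exists_low_degree A'; first by apply/set0Pn; exists x.
rewrite inE => /andP[Az z0]; suff -> : nbrs z :&: A' = nbrs z :&: A.
  by have := Adeg z Az; rewrite -card_gt0 in z0; lia.
apply/setP => w; rewrite !inE; case: (boolP (e z w)) => //= ezw.
case: (boolP (w \in A)) => //= Aw.
by apply/set0Pn; exists z; rewrite !inE e_sym ezw.
Qed.

(** Induction on the vertex set: a vertex with at most one neighbour in the set is put aside, and
    its opinion is then dictated by that neighbour alone, so no conflict arises. *)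
Lemma profile_of_cut (f : rel T) : symmetric f ->
  exists mu : {ffun T -> bool}, forall x y, e x y -> (mu x != mu y) = f x y.
Proof.
move=> f_sym; suff IH k (A : {set T}) : #|A| <= k ->
    exists mu : {ffun T -> bool}, {in A &, forall x y, e x y -> (mu x != mu y) = f x y}.
  have [mu muP] := IH _ setT (leqnn _).
  by exists mu => x y; apply: muP; rewrite inE.
elim: k A => [|k IH] A.
  by rewrite leqn0 cards_eq0 => /eqP->; exists [ffun=> false] => x; rewrite inE.
move=> Ak; have [->|A0] := eqVneq A set0; first by exists [ffun=> false] => x; rewrite inE.
have [x Ax degx] := exists_low_degree A0.
have [|mu muP] := IH (A :\ x); first by have := cardsD1 x A; rewrite Ax; lia.
pose b := if [pick y in nbrs x :&: A] is Some y then f x y (+) mu y else false.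
have bP y : y \in A -> e x y -> (b != mu y) = f x y.
  move=> Ay exy; rewrite /b; case: pickP => [z|/(_ y)]; last by rewrite !inE exy Ay.
  move=> Nz; have -> : z = y.
    apply/eqP; move: degx; rewrite leqNgt; apply: contraNT => zy.
    have <- : #|[set z; y]| = 2 by rewrite cards2 zy.
    apply: subset_leq_card; apply/subsetP => w; rewrite !inE in Nz *.
    by case/pred2P=> ->; rewrite // exy Ay.
  by case: (f x y); case: (mu y).
exists [ffun y => if y == x then b else mu y] => y z Ay Az eyz; rewrite !ffunE.
case: (eqVneq y x) => [yx|yx]; case: (eqVneq z x) => [zx|zx].
- by rewrite yx zx e_irr in eyz.
- by rewrite bP ?yx // -yx.
- by rewrite eq_sym f_sym bP -?zx // e_sym.
- by apply: muP => //; rewrite !inE ?yx ?zx.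
Qed.

(** * Validity in terms of degrees, and sets that every information dominating set meets *)

Lemma same_opposite_degree (mu : {ffun T -> bool}) v :
  #|same_minded e mu v| + #|opposite_minded e mu v| = degree v.
Proof.
rewrite /degree -(cardsID [set w | mu w == mu v] (nbrs v)); congr (_ + _); apply: eq_card => w.
  by rewrite !inE.
by rewrite !inE andbC.
Qed.

Lemma valid_profileP (mu : {ffun T -> bool}) :
  reflect (forall v, 2 * #|opposite_minded e mu v| <= degree v) (valid_profile e mu).
Proof.
by apply: (iffP forallP) => H v; have := H v; have := same_opposite_degree mu v; lia.
Qed.

(* The profiles [mu] and [mu] flipped on [S] cut the boundary edges of [S] whose
   outer end lies in [B], respectively outside [B]. *)
Lemma IDS_hits (S B D : {set T}) : IDS e D -> S != set0 ->
  (forall v, v \notin S -> 2 * #|nbrs v :&: S| <= degree v) ->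
  (forall v, v \in S -> 2 * #|(nbrs v :\: S) :&: B| <= degree v) ->
  (forall v, v \in S -> 2 * #|(nbrs v :\: S) :\: B| <= degree v) ->
  exists2 v, v \in S & v \in D.
Proof.
move=> idsD /set0Pn[x0 Sx0] outS inB inNB.
pose f x y := (x \in S) && (y \in B :\: S) || (y \in S) && (x \in B :\: S).
have [|mu muP] := @profile_of_cut f; first by move=> x y; rewrite /f orbC.
pose nu := [ffun x => mu x (+) (x \in S)].
have vmu : valid_profile e mu.
  apply/valid_profileP => v; case: (boolP (v \in S)) => Sv.
    apply: leq_trans (inB v Sv); rewrite leq_mul2l /=; apply: subset_leq_card.
    apply/subsetP => w; rewrite !inE => /andP[evw]; rewrite eq_sym muP // /f !inE Sv evw /=.
    by rewrite andbF orbF andbT.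
  apply: leq_trans (outS v Sv); rewrite leq_mul2l /=; apply: subset_leq_card.
  apply/subsetP => w; rewrite !inE => /andP[evw]; rewrite eq_sym muP // /f (negPf Sv) evw /=.
  by case/andP.
have vnu : valid_profile e nu.
  apply/valid_profileP => v; case: (boolP (v \in S)) => Sv.
    apply: leq_trans (inNB v Sv); rewrite leq_mul2l /=; apply: subset_leq_card.
    apply/subsetP => w; rewrite !inE !ffunE => /andP[evw]; have := muP _ _ evw.
    rewrite /f !inE Sv evw /= andbF orbF.
    by do 2!case: (mu _); do !case: (_ \in _).
  apply: leq_trans (outS v Sv); rewrite leq_mul2l /=; apply: subset_leq_card.
  apply/subsetP => w; rewrite !inE !ffunE => /andP[evw]; have := muP _ _ evw.
  rewrite /f (negPf Sv) !inE evw Sv /=.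
  by do 2!case: (mu _); do !case: (_ \in _).
have munu : mu != nu.
  by apply/eqP => /ffunP/(_ x0); rewrite ffunE Sx0; case: (mu x0).
move/forallP/(_ mu)/forallP/(_ nu)/implyP: idsD; rewrite vmu vnu munu => /(_ isT).
case/exists_inP => v Dv; rewrite ffunE => Sv; exists v => //.
by move: Sv; case: (v \in S); case: (mu v).
Qed.

(** Supplies the sets [B] for [IDS_hits]: the boundary edges at a vertex are halved, an odd one
    staying outside [B]. *)
Lemma half_subset (X : {set T}) : exists2 B : {set T}, B \subset X & #|B| = #|X|./2.
Proof.
exists [set x in take #|X|./2 (enum X)].
  by apply/subsetP => x; rewrite inE => /mem_take; rewrite mem_enum.
rewrite cardsE (card_uniqP _) ?take_uniq ?enum_uniq // size_takel // -cardE.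
by lia.
Qed.

Definition cluster v : {set T} := v |: [set w | e v w & leaf w].

Lemma leaf_nbr x y z : leaf x -> e x y -> e x z -> y = z.
Proof.
by move=> /cards1P[w wP] exy exz; transitivity w; [|symmetry]; apply/set1P; rewrite -wP inE.
Qed.

Lemma degree_gt1 v x : ~~ leaf_adjacent v -> e v x -> 1 < degree x.
Proof.
move=> /existsPn/(_ x); rewrite /leaf => + evx; rewrite evx /= => degx.
suff : 0 < degree x by lia.
by rewrite card_gt0; apply/set0Pn; exists v; rewrite inE e_sym.
Qed.

Lemma nonadjacent_leaf v x : e v x -> ~~ leaf_adjacent v -> ~~ leaf_adjacent x -> ~~ leaf x.
Proof. by move=> evx /existsPn/(_ x); rewrite evx. Qed.

(** Here [S] is the singleton of [v]: the edges at [v] are halved exactly, and each neighbour of [v]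
    has degree at least two and thus tolerates one disagreement. *)
Lemma IDS_even D v : IDS e D -> ~~ leaf_adjacent v -> ~~ odd (degree v) -> v \in D.
Proof.
move=> idsD nlv evenv; have [B sub cardB] := half_subset (nbrs v).
have NS : nbrs v :\: [set v] = nbrs v.
  by apply/setDidPl; rewrite disjoint_sym disjoints1 inE e_irr.
have [|x|x|x|w] := @IDS_hits [set v] B D idsD.
- by apply/set0Pn; exists v; rewrite inE.
- rewrite inE => xv; have : #|nbrs x :&: [set v]| <= e v x.
    case: (boolP (e v x)) => evx; first by rewrite /= -(cards1 v) subset_leq_card // subsetIr.
    rewrite leqn0 cards_eq0 -subset0; apply/subsetP => y.
    by rewrite !inE => /andP[+ /eqP yv]; rewrite yv e_sym (negPf evx).
  case: (boolP (e v x)) => [evx|_]; last by lia.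
  by have := degree_gt1 nlv evx; lia.
- rewrite inE => /eqP->; rewrite NS (setIidPr sub) cardB -/(degree v); lia.
- rewrite inE => /eqP->; rewrite NS; have := cardsID B (nbrs v).
  have := odd_double_half (degree v).
  by rewrite (setIidPr sub) cardB -/(degree v) (negPf evenv); lia.
- by rewrite inE => /eqP->.
Qed.

(** Here [S] is the cluster. Only [v] has boundary edges, and at least one edge at [v] goes to a
    leaf inside, so even the half rounded up is at most half the degree. An outer neighbour of [v]
    is no leaf and sees only [v] in the cluster. *)
Lemma IDS_cluster D v : IDS e D -> leaf_adjacent v -> exists2 w, w \in cluster v & w \in D.
Proof.
move=> idsD /existsP[l /andP[evl leafl]].
have [B sub cardB] := half_subset (nbrs v :\: cluster v).
have X1 : #|nbrs v :\: cluster v| < degree v.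
  apply: proper_card; apply/properP; split; first exact: subsetDl.
  by exists l; rewrite !inE ?evl ?leafl ?orbT.
have inner x : x \in cluster v -> x != v -> nbrs x :\: cluster v = set0.
  rewrite !inE => /predU1P[->|/andP[evx leafx]]; rewrite ?eqxx // => _.
  apply/setP => y; rewrite !inE; apply/negP => /andP[]; rewrite negb_or => /andP[yv _] exy.
  by move/eqP: yv; apply; apply: (leaf_nbr leafx) => //; rewrite e_sym.
apply: (IDS_hits (B := B) idsD).
- by apply/set0Pn; exists v; rewrite !inE eqxx.
- move=> x; rewrite !inE negb_or => /andP[xv lx].
  have sub1 : #|nbrs x :&: cluster v| <= e v x.
    have sub' : nbrs x :&: cluster v \subset [set y in [set v] | e v x].
      apply/subsetP => y; rewrite !inE => /andP[exy /predU1P[yv|/andP[evy leafy]]].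
        by rewrite yv eqxx -yv e_sym.
      by rewrite (@leaf_nbr y x v) ?eqxx // e_sym // in xv.
    apply: leq_trans (subset_leq_card sub') _.
    case: (boolP (e v x)) => evx.
      rewrite /= -(cards1 v) subset_leq_card //.
      by apply/subsetP => y; rewrite !inE => /andP[].
    by rewrite leqn0 cards_eq0; apply/eqP/setP => y; rewrite !inE andbF.
  apply: leq_trans (leq_mul (leqnn 2) sub1) _.
  case: (boolP (e v x)) => // evx; rewrite evx /= in lx.
  have : 0 < degree x by rewrite card_gt0; apply/set0Pn; exists v; rewrite inE e_sym.
  by rewrite /leaf in lx; lia.
- move=> x Sx; have [->|xv] := eqVneq x v; last by rewrite inner // set0I cards0.
  by rewrite (setIidPr sub) cardB; lia.
- move=> x Sx; have [->|xv] := eqVneq x v; last by rewrite inner // set0D cards0.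
  by have := cardsID B (nbrs v :\: cluster v); rewrite (setIidPr sub) cardB; lia.
Qed.

(** Here [S] consists of [u] and [v]. The edge between them is not cut, which leaves room for
    rounding up half of the other edges at either end. *)
Lemma IDS_edge D u v : IDS e D -> e u v ->
  ~~ leaf_adjacent u -> ~~ leaf_adjacent v ->
  (u \in D) || (v \in D).
Proof.
move=> idsD euv nlu nlv.
have uv : u != v by apply: contraTneq euv => ->; rewrite e_irr.
have [Bu subu cardu] := half_subset (nbrs u :\ v).
have [Bv subv cardv] := half_subset (nbrs v :\ u).
(* Without triangles an outer vertex has at most one neighbour in [S], and [Bu] and [Bv] do not
   interfere, so that their union selects exactly [Bu] at [u] and [Bv] at [v]. *)
have triangle x : e u x -> ~~ e v x.
  move=> eux; apply/negP => evx; have := acyclic_e (c := [:: u; v; x]).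
  rewrite /= euv evx e_sym eux /= !inE negb_or uv => /(_ isT).
  have -> : u != x by apply: contraTneq eux => ->; rewrite e_irr.
  have -> : v != x by apply: contraTneq evx => ->; rewrite e_irr.
  by move/(_ isT).
have Nu : nbrs u :\: [set u; v] = nbrs u :\ v.
  by apply/setP => x; rewrite !inE negb_or; have [->|] := eqVneq x u; rewrite ?e_irr ?andbF.
have Nv : nbrs v :\: [set u; v] = nbrs v :\ u.
  by apply/setP => x; rewrite !inE negb_or; have [->|] := eqVneq x v; rewrite ?e_irr ?andbF ?andbT.
have BuE : (nbrs u :\ v) :&: (Bu :|: Bv) = Bu.
  apply/setP => x; rewrite !inE; apply/idP/idP.
    move=> /andP[/andP[xv eux] /orP[//|/(subsetP subv)]].
    by rewrite !inE (negPf (triangle _ eux)) andbF.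
  by move=> Bx; rewrite Bx; have := subsetP subu _ Bx; rewrite !inE => ->.
have BvE : (nbrs v :\ u) :&: (Bu :|: Bv) = Bv.
  apply/setP => x; rewrite !inE; apply/idP/idP.
    move=> /andP[/andP[xv evx] /orP[/(subsetP subu)|//]].
    by rewrite !inE => /andP[_ /triangle]; rewrite evx.
  by move=> Bx; rewrite Bx orbT; have := subsetP subv _ Bx; rewrite !inE => ->.
have du : degree u = #|nbrs u :\ v|.+1 by rewrite /degree (cardsD1 v) inE euv.
have dv : degree v = #|nbrs v :\ u|.+1 by rewrite /degree (cardsD1 u) inE e_sym euv.
have [|x|x|x|w] := @IDS_hits [set u; v] (Bu :|: Bv) D idsD.
- by apply/set0Pn; exists u; rewrite !inE eqxx.
- rewrite !inE negb_or => /andP[xu xv].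
  have -> : #|nbrs x :&: [set u; v]| = e x u + e x v.
    rewrite (cardsD1 u) (cardsD1 v) !inE !eqxx /= andbT (eq_sym v) uv orbT andbT.
    rewrite addnA -[RHS]addn0; congr (_ + _); apply/eqP; rewrite cards_eq0 -subset0.
    by apply/subsetP => y; rewrite !inE; case: (y == u); case: (y == v); rewrite ?andbF.
  case: (boolP (e x u)) => xu1; case: (boolP (e x v)) => xv1 //.
  - by rewrite e_sym in xu1; have := triangle _ xu1; rewrite e_sym xv1.
  - by rewrite e_sym in xu1; exact: degree_gt1 nlu xu1.
  - by rewrite e_sym in xv1; exact: degree_gt1 nlv xv1.
- by rewrite !inE => /pred2P[]->; rewrite ?Nu ?BuE ?Nv ?BvE ?cardu ?cardv ?du ?dv; clear; lia.
- have := cardsID (Bu :|: Bv) (nbrs u :\ v); have := cardsID (Bu :|: Bv) (nbrs v :\ u).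
  rewrite BuE BvE cardu cardv => H H0.
  by rewrite !inE => /pred2P[]->; rewrite ?Nu ?Nv ?du ?dv; clear -H H0; lia.
- by rewrite !inE => /pred2P[]-> ->; rewrite ?orbT.
Qed.

(** * The local criterion for information domination *)

Definition locally_hit (D : {set T}) v :=
  if leaf_adjacent v then (v \in D) || [exists w, e v w && (leaf w && (w \in D))]
  else odd (degree v) || (v \in D).

Definition exposed (D : {set T}) v :=
  [&& ~~ leaf_adjacent v, odd (degree v) & v \notin D].

Definition criterion (D : {set T}) :=
  [forall v, locally_hit D v] &&
  [forall v, forall w, ~~ [&& e v w, exposed D v & exposed D w]].

(* If the two profiles differed at every neighbour of [v] exactly when they agree
   at [v], the neighbours would be split evenly by the two cuts. *)
Lemma odd_same_side (mu nu : {ffun T -> bool}) v :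
  valid_profile e mu -> valid_profile e nu -> odd (degree v) ->
  exists2 w, e v w & (mu w != nu w) = (mu v != nu v).
Proof.
move=> /valid_profileP/(_ v) mv /valid_profileP/(_ v) nv oddv.
case: (pickP [pred w | e v w && ((mu w != nu w) == (mu v != nu v))]) => [w /andP[evw /eqP]|H].
  by exists w.
have NE : opposite_minded e nu v = nbrs v :\: opposite_minded e mu v.
  apply/setP => w; have := H w; rewrite !inE /=; case: (e v w); rewrite ?andbF //=.
  by case: (mu v); case: (nu v); case: (mu w); case: (nu w).
have := cardsID (opposite_minded e mu v) (nbrs v).
rewrite -NE (setIidPr _) -/(degree v); first by move: mv nv; lia.
by apply/subsetP => w; rewrite !inE => /andP[].
Qed.

(** For sufficiency, let two valid profiles agree on [D]. By [odd_same_side] a leaf differs exactly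
    when its neighbour does, so a hit cluster forces agreement at its centre. A vertex where the
    profiles differ is then of odd degree without leaf neighbours, and [odd_same_side] yields an
    adjacent one of the same kind, so both are exposed. *)
Lemma IDS_criterion D : IDS e D = criterion D.
Proof.
apply/idP/idP => [idsD|/andP[/forallP locD /forallP edgeD]].
  apply/andP; split; apply/forallP => v.
    rewrite /locally_hit; case: (boolP (leaf_adjacent v)) => lv; last first.
      by case: (boolP (odd _)) => // /(IDS_even idsD lv).
    have [w] := IDS_cluster idsD lv; rewrite !inE => /predU1P[->->//|/andP[evw lw] Dw].
    by apply/orP; right; apply/existsP; exists w; rewrite evw lw.
  apply/forallP => w; apply/negP => /and4P[evw /and3P[nlv ov nDv] nlw /andP[ow nDw]].
  by have := IDS_edge idsD evw nlv nlw; rewrite (negPf nDv) (negPf nDw).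
apply/forallP => mu; apply/forallP => nu; apply/implyP => /and3P[vmu vnu].
apply: contraNT; rewrite negb_exists_in => /forall_inP agree.
have inD v : v \in D -> mu v = nu v by move/agree/negPn/eqP.
have leafP l v : e v l -> leaf l -> (mu l != nu l) = (mu v != nu v).
  move=> evl leafl; have [|w elw <-] := @odd_same_side mu nu l vmu vnu.
    by rewrite (eqP leafl).
  by rewrite (@leaf_nbr l w v) // e_sym.
have adjP v : leaf_adjacent v -> mu v = nu v.
  move=> lv; have := locD v; rewrite /locally_hit lv.
  case/orP => [/inD//|/existsP[w /and3P[evw lw /inD muw]]].
  by apply/eqP; have := leafP w v evw lw; rewrite muw eqxx; case: eqVneq.
have evenP v : ~~ leaf_adjacent v -> ~~ odd (degree v) -> mu v = nu v.
  by move=> /negPf nlv ov; have := locD v; rewrite /locally_hit nlv (negPf ov) => /inD.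
apply/eqP/ffunP => v; case: (boolP (leaf_adjacent v)) => [/adjP//|nlv].
case: (boolP (odd (degree v))) => [ov|]; last exact: evenP.
apply/eqP; apply: contraT => Sv; have [w evw] := odd_same_side vmu vnu ov; rewrite Sv => Sw.
have nD x : mu x != nu x -> x \notin D by apply: contraNN => /inD->.
have := edgeD v => /forallP/(_ w); rewrite evw /exposed nlv ov !nD //=.
suff [-> ->] : ~~ leaf_adjacent w /\ odd (degree w) by [].
have nlw : ~~ leaf_adjacent w by apply: contraNN Sw => /adjP->.
by split=> //; apply: contraNT Sw => /(evenP _ nlw)->.
Qed.

End Forests.

(** * Minimum information dominating sets *)

Section Greedy.
Variables (n : nat) (e : rel 'I_n).
Hypotheses (simple_e : simple_graph e) (acyclic_e : acyclic e).

Let e_sym : symmetric e. Proof. by case: simple_e. Qed.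
Let e_irr : irreflexive e. Proof. by case: simple_e. Qed.

(* In a component with two vertices, both of them leaf-adjacent with the same
   cluster, only the smaller one is taken. *)
Definition preferred v w := ~~ leaf e v || (v < w).

(** The existential form is what a single scan of the adjacency list of [v] computes. *)
Definition forced : {set 'I_n} :=
  [set v | if leaf_adjacent e v
           then [exists w, e v w && (leaf e w && preferred v w)]
           else ~~ odd (degree e v)].

(* [m] matches the vertices added to [forced] with removed vertices outside [D]. *)
Definition greedy_cover (A D : {set 'I_n}) : Prop :=
  [/\ forced \subset D,
      forall x y, e x y -> x \notin A -> (x \in D) || (y \in D) &
      exists2 m : 'I_n -> 'I_n, {in D :\: forced &, injective m} &
        {in D :\: forced, forall w, [/\ e (m w) w, m w \notin D & m w \notin A]}].

Lemma greedy_cover_init : greedy_cover setT forced.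
Proof.
split=> // [x y _|]; first by rewrite inE.
by exists id => x; rewrite setDv inE.
Qed.

(** All neighbours of [u] except [w] were removed earlier, so only the edge to [w] may still need
    covering. If [w] enters [D], its partner is [u]: earlier partners lie outside [A], hence differ
    from [u] and from [w]. *)
Lemma greedy_cover_step (A D : {set 'I_n}) u w : greedy_cover A D -> u \in A -> w \in A ->
  e u w -> (forall y, e u y -> y \in A -> y = w) ->
  greedy_cover (A :\ u) (if (u \in D) || (w \in D) then D else w |: D).
Proof.
move=> [subD cov [m minj mP]] Au Aw euw uniqw.
have [uwD|] := ifPn; last rewrite negb_or => /andP[nDu nDw]; split=> //.
- move=> x y exy; rewrite !inE negb_and negbK => /predU1P[xu|]; last exact: cov.
  subst x; have [Ay|nAy] := boolP (y \in A); first by rewrite (uniqw y).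
  by rewrite orbC cov // e_sym.
- exists m => // x Dx; have [emx nDm nAm] := mP x Dx; split=> //.
  by rewrite !inE (negPf nAm) andbF.
- by apply: subset_trans subD (subsetUr _ _).
- move=> x y exy; rewrite !inE negb_and negbK => /predU1P[xu|nAx]; last first.
    by have := cov x y exy nAx => /orP[]->; rewrite !orbT.
  subst x; have [Ay|nAy] := boolP (y \in A); first by rewrite (uniqw y) // eqxx orbT.
  by have := cov y u; rewrite e_sym => /(_ exy nAy) /orP[]->; rewrite !orbT.
have nfw : w \notin forced by apply: contraNN nDw; apply: (subsetP subD).
have inDf x : x \in (w |: D) :\: forced -> x != w -> x \in D :\: forced.
  by rewrite !inE => /andP[-> /orP[/eqP->|//]]; rewrite eqxx.
have mAu x : x \in D :\: forced -> m x != u.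
  by move=> /mP[_ _]; apply: contraNneq => ->.
exists (fun x => if x == w then u else m x).
- move=> x y Dx Dy; have [->|xw] := eqVneq x w; have [->//|yw] := eqVneq y w.
  + by move=> mu; have := mAu y (inDf y Dy yw); rewrite -mu eqxx.
  + by move=> mu; have := mAu x (inDf x Dx xw); rewrite mu eqxx.
  + by apply: minj; apply: inDf.
- move=> x Dx; have [xw|xw] := eqVneq x w.
    rewrite xw !inE eqxx; split=> //; rewrite negb_or nDu andbT.
    by apply: contraTneq euw => ->; rewrite e_irr.
  have [emx nDm nAm] := mP x (inDf x Dx xw); rewrite !inE (negPf nAm) andbF; split=> //.
  by rewrite negb_or nDm andbT; apply: contraNneq nAm => ->.
Qed.

(** Makes [IDS_edge] applicable to matched pairs. If [u] had a leaf neighbour without being forced,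
    [u] would itself be a leaf with [w] as its leaf neighbour, and the smaller of the two would be
    forced. *)
Lemma edge_off_forced u w : e u w -> u \notin forced -> w \notin forced ->
  ~~ leaf_adjacent e u /\ odd (degree e u).
Proof.
move=> euw nfu nfw; suff nlu : ~~ leaf_adjacent e u.
  by move: nfu; rewrite inE (negPf nlu) negbK.
apply/negP => lu; move: (nfu); rewrite inE lu => /existsPn nprefu.
have leafu : leaf e u.
  case/existsP: lu => x /andP[eux lx]; have := nprefu x.
  by rewrite eux lx /preferred negb_or negbK => /andP[].
have leafw : leaf e w.
  by case/existsP: lu => x /andP[eux lx]; rewrite (leaf_nbr leafu euw eux).
have lw : leaf_adjacent e w by apply/existsP; exists u; rewrite e_sym euw.
move: nfw; rewrite inE lw => /existsPn/(_ u); have := nprefu w.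
rewrite (e_sym w) euw leafu leafw /preferred leafu leafw /= => uw wu.
have : (u : nat) = w by clear -uw wu; lia.
by move/val_inj => uw'; rewrite uw' e_irr in euw.
Qed.

(** Choosing an element of [D'] in each [W v] is injective by disjointness. *)
Lemma card_le_disjoint_hits (T : finType) (W : T -> {set T}) (D D' : {set T}) :
  {in D &, forall v w x, x \in W v -> x \in W w -> v = w} ->
  {in D, forall v, exists2 x, x \in W v & x \in D'} -> #|D| <= #|D'|.
Proof.
move=> disjW hitW; pose f v := odflt v [pick x in W v :&: D'].
have fP v : v \in D -> f v \in W v :&: D'.
  move=> /hitW[x Wx Dx]; rewrite /f; case: pickP => [y //|/(_ x)].
  by rewrite inE Wx Dx.
have finj : {in D &, injective f}.
  move=> v w Dv Dw fvw; have := fP w Dw; have := fP v Dv.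
  by rewrite -fvw !inE => /andP[Wv _] /andP[Ww _]; apply: (disjW v w Dv Dw (f v)).
rewrite -(card_in_imset finj); apply: subset_leq_card; apply/subsetP => _ /imsetP[v Dv ->].
by have := fP v Dv; rewrite inE => /andP[].
Qed.

(** The vertices left in [A] span no edge, so [D] covers all edges; this and [forced] give the
    criterion. Minimality is shown by disjoint sets [W v], one for each [v] in [D], that every
    information dominating set meets. *)
Lemma greedy_cover_minimum (A D : {set 'I_n}) : (forall x, x \in A -> #|nbrs e x :&: A| != 1) ->
  greedy_cover A D -> minimum_IDS e D.
Proof.
move=> Adeg [subD cov [m minj mP]].
have cover x y : e x y -> (x \in D) || (y \in D).
  move=> exy; have [Ax|] := boolP (x \in A); last exact: cov.
  have [Ay|nAy] := boolP (y \in A); last by rewrite orbC cov // e_sym.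
  by have := peeled_edgeless simple_e acyclic_e Adeg Ax Ay; rewrite exy.
split.
  rewrite IDS_criterion //; apply/andP; split; apply/forallP => v; last first.
    apply/forallP => w; apply/negP => /and4P[evw /and3P[_ _ nDv] _ /andP[_ nDw]].
    by have := cover v w evw; rewrite (negPf nDv) (negPf nDw).
  rewrite /locally_hit; case: ifPn => lv; last first.
    by case: (boolP (odd _)) => //= ov; apply: (subsetP subD); rewrite inE (negPf lv).
  case/existsP: (lv) => w /andP[evw lw]; case/orP: (cover v w evw) => [->//|Dw].
  by apply/orP; right; apply/existsP; exists w; rewrite evw lw.
move=> D' idsD'.
pose W v := if v \in forced then if leaf_adjacent e v then cluster e v else [set v]
            else [set v; m v].
have matchedP v : v \in D -> v \notin forced ->
    [/\ e v (m v), m v \notin D, ~~ leaf_adjacent e v & odd (degree e v)] /\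
    [/\ ~~ leaf_adjacent e (m v), odd (degree e (m v)), ~~ leaf e v & ~~ leaf e (m v)].
  move=> Dv nfv; have [|emv nDm _] := mP v; first by rewrite inE nfv.
  have nfm : m v \notin forced by apply: contraNN nDm; apply: (subsetP subD).
  have [nlm om] := edge_off_forced emv nfm nfv.
  have evm : e v (m v) by rewrite e_sym.
  have [nlv ov] := edge_off_forced evm nfv nfm.
  by do !split=> //; [apply: nonadjacent_leaf emv _ _|apply: nonadjacent_leaf evm _ _].
(* The facts about [x] in [W v] that separate the three kinds of witness sets. *)
have WP v x : v \in D -> x \in W v ->
    [\/ [/\ x = v, v \in forced, ~~ leaf_adjacent e x & ~~ odd (degree e x)],
        [/\ leaf_adjacent e v, v \in forced & x = v \/ e v x /\ leaf e x] |
        [/\ v \notin forced, x = v \/ x = m v /\ x \notin D, ~~ leaf_adjacent e x,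
            odd (degree e x) & ~~ leaf e x]].
  move=> Dv; rewrite /W; case: ifPn => fv.
    case: ifPn => lv; last first.
      by rewrite inE => /eqP->; constructor 1; split=> //; move: fv; rewrite inE (negPf lv).
    by rewrite !inE => /predU1P[->|/andP[evx lx]]; constructor 2; split=> //; [left|right].
  have [[evm nDm nlv ov] [nlm om nleafv nleafm]] := matchedP v Dv fv.
  by rewrite !inE => /pred2P[]->; constructor 3; split=> //; [left|right].
have leafW x : leaf e x -> odd (degree e x) by move/eqP->.
apply: (@card_le_disjoint_hits _ W) => [v w Dv Dw x|v Dv].
  move=> /(WP v x Dv) Wv /(WP w x Dw) Ww.
  case: Wv => [[xv fv nlx ox]|[lv fv xv]|[nfv xv nlx ox nleafx]];
    case: Ww => [[xw fw nlx' ox']|[lw fw xw]|[nfw xw nlx' ox' nleafx']].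
  - by rewrite -xv -xw.
  - case: xw => [xw|[_ /leafW]]; last by rewrite (negPf ox).
    by rewrite -xw (negPf nlx) in lw.
  - by rewrite ox' in ox.
  - case: xv => [xv|[_ /leafW]]; last by rewrite (negPf ox').
    by rewrite -xv (negPf nlx') in lv.
  (* Two clusters can only overlap in a two-vertex component, where forcing both ends would require
     [a < b] and [b < a]. *)
  - have K2 a b : leaf_adjacent e a -> a \in forced -> leaf_adjacent e b -> b \in forced ->
        e b a -> leaf e a -> False.
      move=> la fa lb fb eba leafa; have eab : e a b by rewrite e_sym.
      have leafb : leaf e b.
        by case/existsP: la => y /andP[eay ly]; rewrite (leaf_nbr leafa eab eay).
      move: fa fb; rewrite !inE la lb => /existsP[y /and3P[eay _ py]] /existsP[z /and3P[ebz _ pz]].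
      rewrite (leaf_nbr leafa eay eab) in py; rewrite (leaf_nbr leafb ebz eba) in pz.
      rewrite /preferred leafa leafb /= in py pz.
      by have := ltn_trans py pz; rewrite ltnn.
    case: xv xw => [xv|[evx lx]] [xw|[ewx lx']].
    + by rewrite -xv.
    + by case: (K2 v w); rewrite // -xv.
    + by case: (K2 w v); rewrite // -xw.
    + by apply: (leaf_nbr lx); rewrite e_sym.
  - case: xv => [xv|[_ lx]]; last by rewrite lx in nleafx'.
    by rewrite -xv (negPf nlx') in lv.
  - by rewrite ox in ox'.
  - case: xw => [xw|[_ lx]]; last by rewrite lx in nleafx.
    by rewrite -xw (negPf nlx) in lw.
  (* Vertices of [D] never equal partners, which lie outside [D]; equal partners come from equal
     vertices since [m] is injective. *)
  - case: xv xw => [xv|[xv nDx]] [xw|[xw nDx']].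
    + by rewrite -xv.
    + by rewrite xv Dv in nDx'.
    + by rewrite xw Dw in nDx.
    + have [Mv Mw] : v \in D :\: forced /\ w \in D :\: forced by rewrite !in_setD nfv nfw.
      by apply: (minj v w Mv Mw); rewrite -xv -xw.
rewrite /W; case: ifPn => fv.
  case: ifPn => lv; first exact: IDS_cluster.
  exists v; first by rewrite inE.
  by apply: (IDS_even simple_e acyclic_e idsD' lv); move: fv; rewrite inE (negPf lv).
have [[evm nDm nlv ov] [nlm om _ _]] := matchedP v Dv fv.
by case/orP: (IDS_edge simple_e acyclic_e idsD' evm nlv nlm) => [|];
  [exists v|exists (m v)]; rewrite // !inE eqxx ?orbT.
Qed.

End Greedy.

(** * Amortized cost of programs *)

(* [mem] alone denotes the membership predicate of ssrbool. *)
Notation cell := Defs.mem.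

(** Total correctness, with the running time visible to the postcondition. *)
Definition runs (p : cmd) (s : state) (post : nat -> state -> Prop) : Prop :=
  exists t s', exec p s t s' /\ post t s'.

Lemma runs_seq p q s post :
  runs p s (fun t s' => runs q s' (fun t' s'' => post (t + t') s'')) ->
  runs (Seq p q) s post.
Proof.
move=> [t [s' [Ep [t' [s'' [Eq post_t]]]]]].
by exists (t + t'), s''; split=> //; apply: ExecSeq Ep Eq.
Qed.

Lemma runs_weaken p s (post post' : nat -> state -> Prop) :
  runs p s post -> (forall t s', post t s' -> post' t s') -> runs p s post'.
Proof. by move=> [t [s' [E H]]] imp; exists t, s'; split=> //; apply: imp. Qed.

(* [pot] pays for the iterations, which makes the bound amortized. *)
Lemma runs_while (G : Type) (inv : G -> state -> Prop) (pot : G -> nat) b p :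
  (forall g s, inv g s -> holds s b ->
     runs p s (fun t s' => exists2 g', inv g' s' & t + (test_cost b).+1 + pot g' <= pot g)) ->
  forall g s, inv g s ->
  runs (While b p) s (fun t s' => exists g',
    [/\ inv g' s', ~~ holds s' b & t + pot g' <= pot g + (test_cost b).+1]).
Proof.
(* Every iteration lowers the potential at least by the cost of its test, so the potential also
   proves termination. *)
move=> step g s; have [m] := ubnP (pot g); elim: m g s => // m IH g s potg invg.
have [hb|nb] := boolP (holds s b); last first.
  exists (test_cost b).+1, s; split; first exact: ExecWhileStop.
  by exists g; split=> //; rewrite addnC.
have [t [s' [Ep [g' invg' le]]]] := step g s invg hb.
have [|t' [s'' [Ew [g'' [invg'' nb le']]]]] := IH g' s' _ invg'; first by lia.
exists ((test_cost b).+1 + t + t'), s''; split; first exact: ExecWhileStep Ep Ew.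
by exists g''; split=> //; lia.
Qed.

(** * Loop-free programs: evaluation, cost bounds and frames *)

Fixpoint loop_free (p : cmd) : bool :=
  match p with
  | Skip | Assign _ _ | Store _ _ _ => true
  | Seq p q | If _ p q => loop_free p && loop_free q
  | While _ _ => false
  end.

(** An upper bound for loop-free programs: both branches of a conditional are added. The value at
    [While] is a dummy, as it is in [run]. *)
Fixpoint max_cost (p : cmd) : nat :=
  match p with
  | Skip => 1
  | Assign _ y => (expr_cost y).+1
  | Store _ i y => (expr_cost i + expr_cost y).+1
  | Seq p q => max_cost p + max_cost q
  | If b p q => (test_cost b).+1 + (max_cost p + max_cost q)
  | While _ _ => 0
  end.

Fixpoint run (p : cmd) (s : state) : state :=
  match p with
  | Skip | While _ _ => s
  | Assign x y => set_reg s x (eval s y)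
  | Store a i y => set_mem s a (eval s i) (eval s y)
  | Seq p q => run q (run p s)
  | If b p q => if holds s b then run p s else run q s
  end.

Lemma exec_loop_free p s : loop_free p -> exists2 t, exec p s t (run p s) & t <= max_cost p.
Proof.
elim: p s => [|x y|a i y|p IHp q IHq|b p IHp q IHq|//] s /=.
- by exists 1 => //; apply: ExecSkip.
- by move=> _; eexists; first exact: ExecAssign.
- by move=> _; eexists; first exact: ExecStore.
- move=> /andP[/(IHp s)[t Ep le] /(IHq (run p s))[t' Eq le']].
  by exists (t + t'); [apply: ExecSeq Ep Eq | apply: leq_add].
- move=> /andP[/(IHp s)[t Ep le] /(IHq s)[t' Eq le']].
  case hb: (holds s b).
  + by exists ((test_cost b).+1 + t); [apply: ExecIf; rewrite hb | rewrite leq_add2l; lia].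
  + by exists ((test_cost b).+1 + t'); [apply: ExecIf; rewrite hb | rewrite leq_add2l; lia].
Qed.

Lemma runs_loop_free p s (post : nat -> state -> Prop) : loop_free p ->
  (forall t, t <= max_cost p -> post t (run p s)) -> runs p s post.
Proof. by move=> /(exec_loop_free s)[t E le] H; exists t, (run p s); split=> //; apply: H. Qed.

(** A syntactic frame condition, settled by computation for concrete programs. *)
Fixpoint spares (R A : seq nat) (p : cmd) : bool :=
  match p with
  | Skip => true
  | Assign x _ => x \notin R
  | Store a _ _ => a \notin A
  | Seq p q | If _ p q => spares R A p && spares R A q
  | While _ p => spares R A p
  end.

Lemma run_spares R A p s : spares R A p ->
  {in R, reg (run p s) =1 reg s} /\ {in A, forall a, cell (run p s) a =1 cell s a}.
Proof.
elim: p s => [|x y|a i y|p IHp q IHq|b p IHp q IHq|] //= s.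
- move=> xR; split=> // z zR /=; case: eqP => // zx.
  by rewrite -zx zR in xR.
- move=> aA; split=> // b bA j /=; case: eqP => // ba.
  by rewrite -ba bA in aA.
- move=> /andP[/(IHp s)[rp mp] /(IHq (run p s))[rq mq]].
  by split=> [x xR|a aA j]; [rewrite rq // rp | rewrite mq // mp].
- by move=> /andP[/(IHp s) ? /(IHq s) ?]; case: (holds s b).
Qed.

(** * Loops over the neighbours of a vertex and over all vertices *)

Section GraphLoops.
Variables (n : nat) (adj : 'I_n -> seq 'I_n).

(** The read-only part of the input; array 2 is left out because the construction writes to it. *)
Definition loaded (s : state) : Prop :=
  [/\ reg s 0 = n,
      forall v : 'I_n, cell s 0 v.+1 = cell s 0 v + size (adj v) &
      forall (v w : 'I_n) l l', adj v = l ++ w :: l' -> cell s 1 (cell s 0 v + size l) = w].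

Lemma loaded_ext s s' : reg s' 0 = reg s 0 -> cell s' 0 =1 cell s 0 -> cell s' 1 =1 cell s 1 ->
  loaded s -> loaded s'.
Proof.
move=> r0 m0 m1 [sr0 sm0 sm1]; split=> [|v|v w l l' adjv]; first by rewrite r0.
  by rewrite !m0.
by rewrite m0 m1 (sm1 v w l l').
Qed.

Lemma loaded_set_reg s x k : x != 0 -> loaded s -> loaded (set_reg s x k).
Proof. by move=> x0; apply: loaded_ext => //=; rewrite eq_sym (negPf x0). Qed.

Lemma loaded_run p s : spares [:: 0] [:: 0; 1] p -> loaded s -> loaded (run p s).
Proof. by move=> /run_spares-/(_ s)[r m]; apply: loaded_ext; [apply: r|apply: m|apply: m]. Qed.

(* Register 1 holds the current vertex, register 2 the position in array 1 and
   register 3 the current neighbour. *)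
Definition for_nbrs (body : cmd) : cmd :=
  Seq (Assign 2 (Get 0 (Reg 1)))
    (While (TLt (Reg 2) (Get 0 (Succ (Reg 1))))
       (Seq (Assign 3 (Get 1 (Reg 2))) (Seq body (Assign 2 (Succ (Reg 2)))))).

Lemma runs_for_nbrs (v : 'I_n) (inv : seq 'I_n -> state -> Prop) body s
    (post : nat -> state -> Prop) :
  loop_free body -> spares [:: 0; 1; 2] [:: 0; 1] body ->
  (forall l s' x k, x \in [:: 2; 3] -> inv l s' -> inv l (set_reg s' x k)) ->
  (forall l (w : 'I_n) s', w \in adj v -> loaded s' -> reg s' 1 = v -> reg s' 3 = w ->
     inv l s' -> inv (rcons l w) (run body s')) ->
  loaded s -> reg s 1 = v -> inv [::] s ->
  (forall t s', t <= (max_cost body + 12) * (size (adj v)).+1 -> loaded s' ->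
     reg s' 1 = v -> inv (adj v) s' -> post t s') ->
  runs (for_nbrs body) s post.
Proof.
move=> lf sp inv23 step lds s1 inv0 fin.
pose J l s' := exists l', [/\ adj v = l ++ l', loaded s', reg s' 1 = v,
  reg s' 2 = cell s' 0 v + size l & inv l s'].
(* One iteration costs 6 for the test and 3 for each of the two assignments besides the body. The
   first assignment and the failing test cost 9, covered by one further [K]. *)
pose K := max_cost body + 12.
pose pot (l : seq 'I_n) := K * (size (adj v) - size l).
apply: runs_seq; apply: runs_loop_free => // t le_t.
have J0 : J [::] (run (Assign 2 (Get 0 (Reg 1))) s).
  exists (adj v); split=> //=; first by rewrite s1 addn0.
  by apply: inv23.
apply: runs_weaken (runs_while (pot := pot) _ J0) _ => [l s' [l' [adjv lds' s'1 s'2 invl]] /=|].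
  rewrite s'1 s'2; case: (lds') => _ m0 m1; rewrite m0 adjv size_cat ltn_add2l => lt_l.
  case: l' adjv lt_l => [|w l'] adjv lt_l; first by rewrite addn0 ltnn in lt_l.
  apply: runs_loop_free => [/=|t' le_t']; first by rewrite lf.
  have wadj : w \in adj v by rewrite adjv mem_cat inE eqxx orbT.
  pose s3 := set_reg s' 3 (cell s' 1 (reg s' 2)).
  have [r m] := run_spares s3 sp.
  exists (rcons l w); last first.
    rewrite /pot adjv size_rcons size_cat /= in le_t' *.
    have -> : size l + (size l').+1 - size l = (size l').+1 by lia.
    have -> : size l + (size l').+1 - (size l).+1 = size l' by lia.
    by rewrite mulnS /K; lia.
  exists l'; split=> /=.
  - by rewrite cat_rcons.
  - by apply: loaded_set_reg => //; apply: loaded_ext lds'; [apply: r|apply: m|apply: m].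
  - by rewrite r.
  - by rewrite size_rcons -/s3 r // (m 0) //= s'2 addnS.
  apply: (inv23) => //; apply: step => //; first by rewrite /= s'2 (m1 v w l l').
  by apply: inv23.
move=> t' s' [l [[l' [adjv lds' s'1 s'2 invl]] /= stop le]].
case: (lds') => _ m0 _; move: stop; rewrite s'1 s'2 m0 adjv size_cat ltn_add2l => stop.
have l'0 : l' = [::] by apply/nilP; rewrite /nilp; lia.
apply: fin => //; last by rewrite adjv l'0 cats0.
rewrite /pot subn0 in le; rewrite mulnS -/K; move: le_t; rewrite /= => le_t.
have : 12 <= K by rewrite /K leq_addl.
by lia.
Qed.

(** The counter is in register 5 and is copied to register 1, since [peel] changes register 1. *)
Definition for_vertices (body : cmd) : cmd :=
  Seq (Assign 5 (Cst 0))
    (While (TLt (Reg 5) (Reg 0))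
       (Seq (Assign 1 (Reg 5)) (Seq body (Assign 5 (Succ (Reg 5)))))).

Definition input_size := \sum_(v < n) (size (adj v)).+1.

(** The body may spend [K] per list entry plus [K] per vertex, and beyond that draw on [pot]. The 9
    is the loop overhead: 4 for the test, 2 and 3 for the assignments. *)
Lemma runs_for_vertices (G : Type) (inv : G -> nat -> state -> Prop) (pot : G -> nat) K
    body g s (post : nat -> state -> Prop) :
  (forall g k s' x j, x \in [:: 1; 5] -> inv g k s' -> inv g k (set_reg s' x j)) ->
  (forall g (v : 'I_n) s', loaded s' -> reg s' 1 = v -> reg s' 5 = v -> inv g v s' ->
     runs body s' (fun t s'' => [/\ loaded s'', reg s'' 5 = v &
       exists2 g', inv g' v.+1 s'' & t + pot g' <= pot g + K * (size (adj v)).+1])) ->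
  loaded s -> inv g 0 s ->
  (forall t s' g', loaded s' -> inv g' n s' ->
     t + pot g' <= pot g + (K + 9) * input_size.+1 -> post t s') ->
  runs (for_vertices body) s post.
Proof.
move=> inv15 step lds inv0 fin.
pose J (h : G * nat) s' := [/\ loaded s', h.2 <= n, reg s' 5 = h.2 & inv h.1 h.2 s'].
(* The budget of the vertices not yet visited. *)
pose rest k := \sum_(v < n | k <= v) (K + 9) * (size (adj v)).+1.
pose pot' (h : G * nat) := pot h.1 + rest h.2.
apply: runs_seq; apply: runs_loop_free => // t le_t.
have J0 : J (g, 0) (run (Assign 5 (Cst 0)) s).
  by split=> //=; apply: inv15.
apply: runs_weaken (runs_while (pot := pot') _ J0) _ => [[g1 k] s' [lds' le_k s'5 invk] /=|].
  have [r0 _ _] := lds'; rewrite r0 s'5 /= => lt_k.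
  pose v := Ordinal lt_k; apply: runs_seq; apply: runs_loop_free => // t1 le_t1.
  apply: runs_seq; apply: runs_weaken (step g1 v _ _ _ _ _) _ => //=; first by apply: inv15.
  move=> t2 s2 [lds2 s25 [g2 inv2 le2]]; apply: runs_loop_free => // t3 le_t3.
  exists (g2, k.+1); first split=> //=.
  - by rewrite s25.
  - by apply: inv15.
  rewrite /pot' /=; have -> : rest k = (K + 9) * (size (adj v)).+1 + rest k.+1.
    rewrite /rest (bigD1 v) //=; congr (_ + _); apply: eq_bigl => w.
    by rewrite andbC -(inj_eq val_inj) /= ltn_neqAle eq_sym.
  by rewrite /= in le_t1 le_t3; lia.
move=> t' s' [[g' k] [[lds' le_k s'5 inv'] /= stop le]].
have [r0 _ _] := lds'; rewrite r0 s'5 /= -leqNgt in stop.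
have kn : k = n by apply/eqP; rewrite eqn_leq le_k.
rewrite /= in le_t; apply: (fin _ _ g') => //; first by rewrite /= kn in inv'.
have r_n : rest k = 0 by apply: big1 => w; rewrite kn leqNgt ltn_ord.
have r_0 : rest 0 = (K + 9) * input_size by rewrite /rest big_distrr; apply: eq_bigl.
by rewrite /pot' /= r_n r_0 in le; rewrite mulnS; lia.
Qed.

End GraphLoops.

(** * The input encoding and its size *)

Lemma nth_offset (s : seq nat) k : k <= size s ->
  nth 0 (0 :: scanl addn 0 s) k = sumn (take k s).
Proof.
have foldlE x s' : foldl addn x s' = x + sumn s'.
  by elim: s' x => [|y s' IH] x /=; rewrite ?addn0 // IH addnA.
by case: k => [|k] lt_k /=; rewrite ?take0 // nth_scanl // foldlE.
Qed.

Lemma nth_flatten_offset (T : Type) (x0 : T) (ss : seq (seq T)) v k :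
  v < size ss -> k < size (nth [::] ss v) ->
  nth x0 (flatten ss) (sumn (take v (shape ss)) + k) = nth x0 (nth [::] ss v) k.
Proof.
elim: ss v => // s ss IH [|v] /= lt_v lt_k; first by rewrite nth_cat lt_k.
by rewrite -addnA nth_cat ltnNge leq_addr /= addKn IH.
Qed.

(** The degree sum counts ordered adjacent pairs, and an unordered edge comes from at most two of
    them. *)
Lemma sum_degree_edges (T : finType) (e : rel T) :
  \sum_v degree e v <= 2 * #|edges e|.
Proof.
pose h (p : T * T) := [set p.1; p.2].
have -> : \sum_v degree e v = \sum_(p in [set p : T * T | e p.1 p.2]) 1.
  rewrite (eq_bigl (fun p : T * T => e p.1 p.2)) => [|p]; last by rewrite inE.
  rewrite -(pair_big_dep predT e (fun _ _ => 1)) /=; apply: eq_bigr => v _.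
  by rewrite /degree /nbrs cardsE sum1_card.
rewrite (partition_big_imset h) /= mulnC -sum_nat_const.
apply: leq_sum => _ /imsetP[q _ ->].
have c2 : #|[set q; (q.2, q.1)]| <= 2 by rewrite cards2; case: eqP.
rewrite sum1_card; apply: leq_trans c2; apply: subset_leq_card; apply/subsetP => -[x y].
case: q => a b; rewrite !inE /= /h /= => /andP[_ /eqP/setP E].
have := E x; have := E y; have := E a; have := E b; rewrite !inE !eqxx ?orbT /=.
rewrite !xpair_eqE (eq_sym x a) (eq_sym y a) (eq_sym x b) (eq_sym y b).
by do 4!case: eqP => //=.
Qed.

Section Input.
Variables (n : nat) (e : rel 'I_n) (adj : 'I_n -> seq 'I_n).
Hypothesis adjP : adjacency_lists e adj.

Lemma size_adj v : size (adj v) = degree e v.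
Proof.
have [uniqv memv] := adjP v; rewrite -(card_uniqP uniqv); apply: eq_card => w.
by rewrite memv inE.
Qed.

Lemma mem_adj v w : (w \in adj v) = e v w.
Proof. by have [_ ->] := adjP v. Qed.

Lemma has_adj v (a : pred 'I_n) : has a (adj v) = [exists w, e v w && a w].
Proof.
apply/hasP/existsP => [[w]|[w /andP[evw aw]]]; last by exists w; rewrite ?mem_adj.
by rewrite mem_adj => evw aw; exists w; rewrite evw.
Qed.

Lemma input_size_le : input_size adj <= 2 * graph_size e.
Proof.
rewrite /input_size /graph_size card_ord.
rewrite (eq_bigr (fun v => 1 + degree e v)) => [|v _]; last by rewrite size_adj.
by rewrite big_split /= sum_nat_const card_ord muln1 mulnDr leq_add ?leq_pmull ?sum_degree_edges.
Qed.

Lemma input_loaded D : loaded adj (input adj D).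
Proof.
pose ss := [seq [seq val w | w <- adj v] | v <- enum 'I_n].
have sizes : [seq size (adj v) | v <- enum 'I_n] = shape ss.
  by rewrite /shape /ss -map_comp; apply: eq_map => v /=; rewrite size_map.
have size_ss : size ss = n by rewrite size_map size_enum_ord.
have nth_ss (v : 'I_n) : nth [::] ss v = [seq val w | w <- adj v].
  by rewrite (nth_map v) ?size_enum_ord // nth_ord_enum.
have m0 k : k <= n -> cell (input adj D) 0 k = sumn (take k (shape ss)).
  by move=> le_k; rewrite /= sizes nth_offset // size_map size_ss.
split=> [//|v|v w l l' adjv]; rewrite !m0 // ?(ltnW (ltn_ord v)) //.
  have lt_v : v < size (shape ss) by rewrite size_map size_ss.
  rewrite (take_nth 0 lt_v) sumn_rcons.
  by rewrite (nth_map [::]) ?size_ss // nth_ss size_map.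
rewrite [LHS](nth_flatten_offset 0) ?size_ss // nth_ss.
  by rewrite adjv map_cat nth_cat size_map ltnn subnn.
by rewrite adjv size_map size_cat /= addnS ltnS leq_addr.
Qed.

Lemma cell_input_set D (v : 'I_n) : cell (input adj D) 2 v = (v \in D).
Proof. by rewrite /= (nth_map v) ?size_enum_ord // nth_ord_enum. Qed.

End Input.

(** * The two programs *)

(** Comparing consecutive offsets takes constant time and does not rely on the vertex having been
    surveyed. *)
Definition leaf_test r := TEq (Get 0 (Succ (Reg r))) (Succ (Get 0 (Reg r))).
Definition toggle := If (TEq (Reg 4) (Cst 0)) (Assign 4 (Cst 1)) (Assign 4 (Cst 0)).
Definition count_nbr := Store 3 (Reg 1) (Succ (Get 3 (Reg 1))).
Definition note q :=
  If (leaf_test 3) (Seq (Assign 6 (Cst 1)) (If q (Assign 7 (Cst 1)) Skip)) Skip.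

(* For the current vertex: its degree is added to its cell of array 3, and the
   parity of the degree, the presence of a leaf neighbour, and the presence of a
   leaf neighbour passing the test [q] go to the registers 4, 6 and 7. *)
Definition survey q :=
  Seq (Assign 4 (Cst 0)) (Seq (Assign 6 (Cst 0)) (Seq (Assign 7 (Cst 0))
    (for_nbrs (Seq toggle (Seq count_nbr (note q)))))).

(** Register 8 is the rejection flag; array 4 collects the exposed vertices for the second scan. *)
Definition judge :=
  If (TEq (Reg 6) (Cst 0))
    (If (TEq (Get 2 (Reg 1)) (Cst 0))
       (If (TEq (Reg 4) (Cst 0)) (Assign 8 (Cst 1)) (Store 4 (Reg 1) (Cst 1)))
       Skip)
    (If (TAnd (TEq (Get 2 (Reg 1)) (Cst 0)) (TEq (Reg 7) (Cst 0)))
       (Assign 8 (Cst 1)) Skip).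

Definition in_D_test := TEq (Get 2 (Reg 3)) (Cst 1).

Definition compare :=
  for_nbrs (If (TAnd (TEq (Get 4 (Reg 1)) (Cst 1)) (TEq (Get 4 (Reg 3)) (Cst 1)))
              (Assign 8 (Cst 1)) Skip).

Definition IDS_decider :=
  Seq (for_vertices (Seq (survey in_D_test) judge))
    (Seq (for_vertices compare)
       (If (TEq (Reg 8) (Cst 0)) (Assign 0 (Cst 1)) (Assign 0 (Cst 0)))).

(** A disjunction in De Morgan form, as tests only offer negation and conjunction. *)
Definition preferred_test := TNot (TAnd (leaf_test 1) (TNot (TLt (Reg 1) (Reg 3)))).

Definition force :=
  If (TEq (Reg 6) (Cst 0))
    (If (TEq (Reg 4) (Cst 0)) (Store 2 (Reg 1) (Cst 1)) Skip)
    (If (TEq (Reg 7) (Cst 0)) Skip (Store 2 (Reg 1) (Cst 1))).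

(** Array 3 counts remaining neighbours. It is 0 at removed vertices, while a remaining neighbour of
    the current vertex still counts that vertex. *)
Definition find_alive_nbr :=
  for_nbrs (If (TEq (Get 3 (Reg 3)) (Cst 0)) Skip (Assign 4 (Reg 3))).

Definition remove :=
  Seq (If (TAnd (TEq (Get 2 (Reg 1)) (Cst 0)) (TEq (Get 2 (Reg 4)) (Cst 0)))
         (Store 2 (Reg 4) (Cst 1)) Skip)
    (Seq (Store 3 (Reg 1) (Cst 0))
       (Seq (Store 3 (Reg 4) (Pred (Get 3 (Reg 4)))) (Assign 1 (Reg 4)))).

(* Removing a vertex of degree 1 can create only one new such vertex, its
   neighbour, and the inner loop continues from there. *)
Definition peel := While (TEq (Get 3 (Reg 1)) (Cst 1)) (Seq find_alive_nbr remove).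

Definition minimum_IDS_finder :=
  Seq (for_vertices (Seq (survey preferred_test) force)) (for_vertices peel).

Section Programs.
Variables (n : nat) (e : rel 'I_n) (adj : 'I_n -> seq 'I_n).
Hypothesis adjP : adjacency_lists e adj.

Lemma holds_leaf_test s r (v : 'I_n) :
  loaded adj s -> reg s r = v -> holds s (leaf_test r) = leaf e v.
Proof.
by move=> [_ m0 _] /= ->; rewrite m0 (size_adj adjP) -addn1 eqn_add2l.
Qed.

Lemma forall_ltS (P : pred 'I_n) (v : 'I_n) :
  [forall u : 'I_n, (u < v.+1) ==> P u] = [forall u : 'I_n, (u < v) ==> P u] && P v.
Proof.
apply/forallP/andP => [H|[/forallP H Pv] u].
  split; last by have := H v; rewrite ltnSn.
  by apply/forallP => u; apply/implyP => uv; have := H u; rewrite ltnS ltnW.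
apply/implyP; rewrite ltnS leq_eqVlt => /predU1P[/val_inj->//|uv].
by have := H u; rewrite uv.
Qed.

Definition survey_frame (v : 'I_n) (s s' : state) : Prop :=
  (forall x, x \notin [:: 2; 3; 4; 6; 7] -> reg s' x = reg s x) /\
  (forall a (i : nat), (a != 3) || (i != v) -> cell s' a i = cell s a i).

Lemma survey_frame_reg v s s' x k : x \in [:: 2; 3; 4; 6; 7] ->
  survey_frame v s s' -> survey_frame v s (set_reg s' x k).
Proof.
move=> xin [r m]; split=> // y yin /=; case: eqP => [yx|_]; last exact: r.
by rewrite yx xin in yin.
Qed.

(** The 46 is made up of 28 for the loop body without [q], 12 for the loop itself and 6 for the
    three resets. *)
Lemma runs_survey q (P : pred 'I_n) (v : 'I_n) s (post : nat -> state -> Prop) :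
  loaded adj s -> reg s 1 = v ->
  (forall s' (w : 'I_n), survey_frame v s s' -> loaded adj s' -> reg s' 1 = v ->
     reg s' 3 = w -> holds s' q = P w) ->
  (forall t s', t <= (test_cost q + 46) * (size (adj v)).+1 -> loaded adj s' ->
     survey_frame v s s' -> reg s' 4 = odd (degree e v) -> reg s' 6 = leaf_adjacent e v ->
     reg s' 7 = [exists w, e v w && (leaf e w && P w)] ->
     cell s' 3 v = cell s 3 v + degree e v -> post t s') ->
  runs (survey q) s post.
Proof.
move=> lds s1 qP fin.
apply: runs_seq; apply: runs_loop_free => // t1 le1.
apply: runs_seq; apply: runs_loop_free => // t2 le2.
apply: runs_seq; apply: runs_loop_free => // t3 le3.
pose inv l s' := [/\ survey_frame v s s', reg s' 4 = odd (size l), reg s' 6 = has (leaf e) l,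
  reg s' 7 = has (fun w => leaf e w && P w) l & cell s' 3 v = cell s 3 v + size l].
apply: (@runs_for_nbrs _ adj v inv) => //.
- move=> l s' x k; rewrite !inE => /pred2P[]-> [fr r4 r6 r7 m3];
    by split=> //; apply: survey_frame_reg.
- move=> l w s' wadj lds' s'1 s'3 [fr r4 r6 r7 m3].
  rewrite -[run _ s']/(run (note q) (run count_nbr (run toggle s'))).
  have -> : run toggle s' = set_reg s' 4 (~~ odd (size l)).
    by rewrite /= r4; case: (odd _).
  set s2 := run count_nbr _.
  have lds2 : loaded adj s2 by apply: loaded_run => //; apply: loaded_set_reg.
  have fr2 : survey_frame v s s2.
    have [rf mf] := survey_frame_reg (x := 4) (~~ odd (size l)) isT fr.
    split=> // a i ai; rewrite -mf //= s'1.
    by case: ifP => // /andP[/eqP a3 /eqP iv]; rewrite a3 iv !eqxx in ai.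
  have s21 : reg s2 1 = v by [].
  have s23 : reg s2 3 = w by [].
  rewrite /note -[run _ s2]/(if holds s2 (leaf_test 3) then
    if holds (set_reg s2 6 1) q then set_reg (set_reg s2 6 1) 7 1 else set_reg s2 6 1 else s2).
  rewrite (holds_leaf_test lds2 s23).
  rewrite (qP _ w) //; last exact: survey_frame_reg.
  have m2 : cell s2 3 v = cell s 3 v + (size l).+1 by rewrite /= s'1 eqxx m3 addnS.
  case lw: (leaf e w); last first.
    by split; rewrite ?size_rcons ?has_rcons ?lw //=.
  case pw: (P w); split; rewrite ?size_rcons ?has_rcons ?lw ?pw //=.
  + by do 2![apply: survey_frame_reg => //].
  + exact: survey_frame_reg.
- split=> [||||/=] //; last by rewrite addn0.
  by do 3![apply: survey_frame_reg => //].
move=> t s' le_t lds' s'1 [fr r4 r6 r7 m3]; apply: fin => //.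
- by rewrite /= in le_t le1 le2 le3; move: le_t le1 le2 le3; clear; lia.
- by rewrite r4 (size_adj adjP).
- by rewrite r6 (has_adj adjP).
- by rewrite r7 (has_adj adjP).
- by rewrite m3 (size_adj adjP).
Qed.

(** * Deciding information domination *)

Section Decision.
Variable D : {set 'I_n}.

Definition judged k s : Prop :=
  [/\ forall v : 'I_n, cell s 2 v = (v \in D),
      forall v : 'I_n, cell s 4 v = (v < k) && exposed e D v &
      (reg s 8 == 0) = [forall v : 'I_n, (v < k) ==> locally_hit e D v]].

Lemma run_judge (v : 'I_n) s (la o d h : bool) :
  reg s 1 = v -> reg s 4 = o -> reg s 6 = la -> reg s 7 = h -> cell s 2 v = d ->
  run judge s = if la then if d || h then s else set_reg s 8 1
                else if d then s else if o then set_mem s 4 v 1 else set_reg s 8 1.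
Proof.
move=> s1 s4 s6 s7 m2; rewrite /= s1 s4 s6 s7 m2.
by case: la {s6}; case: d {m2}; case: h {s7}; case: o {s4}.
Qed.

Lemma judged_step (v : 'I_n) s s' : loaded adj s' -> judged v s -> survey_frame v s s' ->
  reg s' 1 = v -> reg s' 4 = odd (degree e v) -> reg s' 6 = leaf_adjacent e v ->
  reg s' 7 = [exists w, e v w && (leaf e w && (w \in D))] -> judged v.+1 (run judge s').
Proof.
move=> lds' [m2 m4 r8] [fr fm] s'1 s'4 s'6 s'7.
have m2' u : cell s' 2 u = cell s 2 u by apply: fm.
have m4' u : cell s' 4 u = cell s 4 u by apply: fm.
have r8' : reg s' 8 = reg s 8 by apply: fr.
rewrite (@run_judge v _ _ _ (v \in D) _ s'1 s'4 s'6 s'7); last by rewrite m2' m2.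
have ltS (u : 'I_n) : (u < v.+1) = (u < v) || (u == v).
  by rewrite ltnS leq_eqVlt orbC -(inj_eq val_inj).
rewrite /judged forall_ltS -r8 -r8' /locally_hit.
have expE (u : 'I_n) : (u < v.+1) && exposed e D u =
    (u < v) && exposed e D u || (u == v) && exposed e D v.
  by rewrite ltS andb_orl; have [->|] := eqVneq u v.
(* Covers all cases in which [v] is not exposed: there [judge] changes at most register 8. *)
have quiet st : cell st 2 =1 cell s' 2 -> cell st 4 =1 cell s' 4 -> ~~ exposed e D v ->
    (forall u : 'I_n, cell st 2 u = (u \in D)) /\
    (forall u : 'I_n, cell st 4 u = (u < v.+1) && exposed e D u).
  move=> st2 st4 /negPf nexp; split=> u; first by rewrite st2 m2' m2.
  by rewrite st4 m4' m4 expE nexp andbF orbF.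
case la: (leaf_adjacent e v).
  have nexp : ~~ exposed e D v by rewrite /exposed la.
  by case: ifP => dh; [have [] := quiet s' | have [] := quiet (set_reg s' 8 1)];
    rewrite ?andbT ?andbF.
case dv: (v \in D).
  have nexp : ~~ exposed e D v by rewrite /exposed dv andbF andbF.
  by have [] := quiet s' => //; rewrite orbT andbT.
case: ifP => ov; rewrite orbF; last first.
  have nexp : ~~ exposed e D v by rewrite /exposed ov andbF.
  by have [] := quiet (set_reg s' 8 1); rewrite ?andbF.
split=> [u|u|]; rewrite ?andbT //=; first by rewrite m2' m2.
rewrite expE m4' m4 (inj_eq val_inj) [X in _ = nat_of_bool (_ || _ && X)]/exposed la ov dv /=.
by case: (u == v); rewrite ?orbT ?orbF.
Qed.

Lemma IDS_decider_correct :
  simple_graph e -> acyclic e ->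
  runs_linear 500 (graph_size e) IDS_decider (input adj D)
    (fun s => output_bool s (IDS e D)).
Proof.
move=> simple_e acyclic_e; rewrite /runs_linear.
suff [t [s' [E [le H]]]] : runs IDS_decider (input adj D)
    (fun t s' => t <= 500 * (graph_size e).+1 /\ output_bool s' (IDS e D)) by exists t, s'.
apply: runs_seq.
pose inv1 (_ : unit) k s := judged k s.
apply: (@runs_for_vertices _ adj unit inv1 (fun _ => 0) 100 _ tt)
  => [g k s x j|g v s lds s1 s5 J|||].
- by rewrite !inE => /pred2P[]->.
- apply: runs_seq; apply: (runs_survey (P := fun w => w \in D) lds s1) => [s' w [_ fm] _ _ s'3|].
    by rewrite /= s'3 fm // (let: And3 m2 _ _ := J in m2 w); case: (w \in D).
  move=> t s' le_t lds' fr s'4 s'6 s'7 _.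
  have s'1 : reg s' 1 = v by rewrite -s1; case: fr => ->.
  apply: runs_loop_free => // t' le_t'; have [rj _] := @run_spares [:: 5] [::] judge s' isT.
  split.
  + exact: loaded_run.
  + by rewrite rj // -s5; case: fr => ->.
  + exists tt; first exact: judged_step J fr s'1 s'4 s'6 s'7.
    by rewrite !addn0; move: le_t le_t'; rewrite /=; clear; lia.
- exact: input_loaded.
- split=> [v|v|]; first exact: cell_input_set.
    by [].
  by symmetry; apply/forallP => v; rewrite ltn0.
move=> t1 s1 _ lds1 [m2 m4 r8]; rewrite !add0n !addn0 => le1.
have {}r8 : (reg s1 8 == 0) = [forall v, locally_hit e D v].
  by rewrite r8; apply: eq_forallb => v; rewrite ltn_ord.
have {}m4 (v : 'I_n) : cell s1 4 v = exposed e D v by rewrite m4 ltn_ord.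
pose clash v w := exposed e D v && exposed e D w.
(* The second scan keeps the verdict of the first and adds the edges with two exposed ends. *)
pose inv2 (_ : unit) k s := (forall v : 'I_n, cell s 4 v = exposed e D v) /\
  (reg s 8 == 0) = [forall v, locally_hit e D v] &&
    [forall v : 'I_n, (v < k) ==> ~~ has (clash v) (adj v)].
apply: runs_seq.
apply: (@runs_for_vertices _ adj unit inv2 (fun _ => 0) 100 _ tt) => //.
- by move=> g k s x j; rewrite !inE => /pred2P[]->.
- move=> g v s lds sv s5 [c4 c8].
  pose inv3 l s' := [/\ reg s' 5 = v, forall v : 'I_n, cell s' 4 v = exposed e D v &
    (reg s' 8 == 0) = (reg s 8 == 0) && ~~ has (clash v) l].
  apply: (@runs_for_nbrs _ adj v inv3) => // [l s' x k|l w s' _ _ s'1 s'3 [r5 c4' c8']||].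
  + by rewrite !inE => /pred2P[]-> [].
  + by rewrite /= s'1 s'3 !c4' !eqb1; case: ifP => cl;
      split=> //=; rewrite has_rcons /clash cl ?andbF.
  + by split=> //; rewrite andbT.
  move=> t s' le_t lds' s'1 [r5 c4' c8']; split=> //; exists tt.
    split=> //; rewrite c8' c8 -andbA; congr (_ && _).
    by rewrite (forall_ltS (fun v => ~~ has (clash v) (adj v))).
  by rewrite !addn0; move: le_t; rewrite /=; clear; lia.
- split=> //; rewrite r8; set b := [forall v, _]; rewrite -[LHS]andbT; congr (_ && _).
  by symmetry; apply/forallP => v; rewrite ltn0.
move=> t2 s2 _ lds2 [_ c8]; rewrite !add0n !addn0 => le2.
apply: runs_loop_free => // t3 le3; split.
  (* Each scan costs at most [109 * (input_size adj).+1], and [input_size adj] is at most twice the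
     graph size, so 500 suffices. *)
  have := input_size_le adjP; rewrite /= in le3; move: le1 le2 le3; clear.
  by lia.
rewrite /output_bool /=; have -> : IDS e D = (reg s2 8 == 0).
  rewrite c8 IDS_criterion //; congr (_ && _); apply: eq_forallb => v; rewrite ltn_ord /=.
  rewrite (has_adj adjP) negb_exists; apply: eq_forallb => w.
  by [].
by case: eqP.
Qed.

End Decision.

(** * Constructing a minimum information dominating set *)

Section Construction.

Definition prepared k s : Prop :=
  [/\ forall v : 'I_n, cell s 2 v = (v < k) && (v \in forced e) &
      forall v : 'I_n, cell s 3 v = if v < k then degree e v else 0].

Lemma run_force (v : 'I_n) s :
  reg s 1 = v -> reg s 4 = odd (degree e v) -> reg s 6 = leaf_adjacent e v ->
  reg s 7 = [exists w, e v w && (leaf e w && preferred e v w)] ->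
  run force s = if v \in forced e then set_mem s 2 v 1 else s.
Proof.
move=> s1 s4 s6 s7; rewrite inE /= s1 s4 s6 s7.
by case: (leaf_adjacent e v) => /=; [case: [exists w, _] | case: (odd _)].
Qed.

Lemma prepared_step (v : 'I_n) s s' : prepared v s -> survey_frame v s s' ->
  reg s' 1 = v -> reg s' 4 = odd (degree e v) -> reg s' 6 = leaf_adjacent e v ->
  reg s' 7 = [exists w, e v w && (leaf e w && preferred e v w)] ->
  cell s' 3 v = cell s 3 v + degree e v -> prepared v.+1 (run force s').
Proof.
move=> [m2 m3] [_ fm] s'1 s'4 s'6 s'7 m3v; rewrite (run_force s'1 s'4 s'6 s'7).
have ltS (u : 'I_n) : (u < v.+1) = (u < v) || (u == v).
  by rewrite ltnS leq_eqVlt orbC -(inj_eq val_inj).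
have m2' (u : 'I_n) : cell s' 2 u = (u < v) && (u \in forced e) by rewrite fm // m2.
have m3' (u : 'I_n) : cell s' 3 u = if u < v.+1 then degree e u else 0.
  rewrite ltS; have [->|uv] := eqVneq u v; first by rewrite orbT m3v m3 ltnn.
  by rewrite orbF fm ?m3 //; apply: contraNneq uv => /val_inj->.
split=> u; case: (boolP (v \in forced e)) => fv //=; rewrite m2' ltS ?(inj_eq val_inj).
  by have [->|] := eqVneq u v; rewrite ?fv ?orbT ?orbF.
by have [->|] := eqVneq u v; rewrite ?(negPf fv) ?orbT ?orbF ?andbF.
Qed.

(* [A] is the set of vertices that are not yet removed. *)
Definition peeled (A D : {set 'I_n}) s : Prop :=
  [/\ greedy_cover e A D,
      forall v : 'I_n, cell s 2 v = (v \in D) &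
      forall v : 'I_n, cell s 3 v = if v \in A then #|nbrs e v :&: A| else 0].

Hypothesis simple_e : simple_graph e.

Let e_sym : symmetric e. Proof. by case: simple_e. Qed.
Let e_irr : irreflexive e. Proof. by case: simple_e. Qed.

(** Since [w] is the only remaining neighbour of [x], among the vertices that stay only the count of
    [w] changes. *)
Lemma run_remove (x w : 'I_n) (A D : {set 'I_n}) s :
  reg s 1 = x -> reg s 4 = w -> peeled A D s -> x \in A -> nbrs e x :&: A = [set w] ->
  let s' := run remove s in
  [/\ peeled (A :\ x) (if (x \in D) || (w \in D) then D else w |: D) s', reg s' 1 = w &
      forall u : 'I_n, u != x -> u != w -> cell s' 3 u = cell s 3 u].
Proof.
move=> s1 s4 [gc m2 m3] Ax Nx.
have /andP[exw Aw] : e x w && (w \in A).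
  by have := set11 w; rewrite -Nx !inE.
have xw : (x == w) = false by apply: contraTF exw => /eqP->; rewrite e_irr.
have uniqw y : e x y -> y \in A -> y = w.
  by move=> exy Ay; apply/set1P; rewrite -Nx !inE exy.
set s0 := run (If (TAnd (TEq (Get 2 (Reg 1)) (Cst 0)) (TEq (Get 2 (Reg 4)) (Cst 0)))
                 (Store 2 (Reg 4) (Cst 1)) Skip) s.
have E0 : s0 = if (x \in D) || (w \in D) then s else set_mem s 2 w 1.
  by rewrite /s0 /= s1 s4 !m2; case: (x \in D); case: (w \in D).
have s01 : reg s0 1 = x by rewrite E0; case: ifP.
have s04 : reg s0 4 = w by rewrite E0; case: ifP.
have m03 u : cell s0 3 u = cell s 3 u by rewrite E0; case: ifP.
have m02 (u : 'I_n) : cell s0 2 u = (u \in if (x \in D) || (w \in D) then D else w |: D).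
  rewrite E0; case: ifP => _ /=; first exact: m2.
  by rewrite m2 (inj_eq val_inj) !inE; case: eqP.
have -> : run remove s = set_reg (set_mem (set_mem s0 3 x 0) 3 w (cell s 3 w).-1) 1 w.
  rewrite -[run remove s]/(set_reg (set_mem (set_mem s0 3 (reg s0 1) 0) 3 (reg s0 4)
     (cell (set_mem s0 3 (reg s0 1) 0) 3 (reg s0 4)).-1) 1 (reg s0 4)).
  by rewrite s01 s04 /= (inj_eq val_inj) eq_sym xw m03.
move=> s'; split=> //; last first.
  by move=> u ux uw; rewrite /= !(inj_eq val_inj) (negPf ux) (negPf uw) m03.
split=> [|//|u]; first exact: greedy_cover_step.
rewrite /= !(inj_eq val_inj) m03 !m3 !inE Aw.
have [->|uw] := eqVneq u w.
  rewrite eq_sym xw Aw (cardsD1 x (nbrs e w :&: A)) !inE e_sym exw Ax /=.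
  by rewrite setIDA.
have [//|ux] /= := eqVneq u x; case: ifP => // Au; apply: eq_card => y; rewrite !inE.
have [->|//] := eqVneq y x; rewrite /= andbF; apply/negP => /andP[eux _].
by rewrite (uniqw u) ?eqxx // e_sym in uw.
Qed.

(** Each remaining vertex keeps the budget for its own removal: at degree [d] at most [20 * d.+1]
    for the scan, 24 for [remove] and 10 reserved for the loop test. *)
Definition potential (A : {set 'I_n}) := \sum_(u in A) 60 * (size (adj u)).+1.

Lemma runs_peel_step (x : 'I_n) (A D : {set 'I_n}) s (post : nat -> state -> Prop) :
  loaded adj s -> reg s 1 = x -> peeled A D s -> cell s 3 x = 1 ->
  (forall t s' A' D' (x' : 'I_n), t + 10 + potential A' <= potential A -> loaded adj s' ->
     reg s' 1 = x' -> reg s' 5 = reg s 5 -> peeled A' D' s' ->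
     (forall u : 'I_n, u != x' -> cell s 3 u != 1 \/ u = x -> cell s' 3 u != 1) ->
     post t s') ->
  runs (Seq find_alive_nbr remove) s post.
Proof.
move=> lds s1 pl c3 fin; have [gc m2 m3] := pl.
have Ax : x \in A by move: c3; rewrite m3; case: (x \in A).
have /eqP/cards1P[w Nx] : #|nbrs e x :&: A| = 1 by move: c3; rewrite m3 Ax.
have /andP[exw Aw] : e x w && (w \in A).
  by have := set11 w; rewrite -Nx !inE.
(* All other neighbours of [x] are removed and have count 0, so register 4 keeps [w] once it is
   found. *)
pose inv (l : seq 'I_n) s' := [/\ reg s' 5 = reg s 5, forall a, cell s' a =1 cell s a &
  w \in l -> reg s' 4 = w].
apply: runs_seq; apply: (@runs_for_nbrs _ adj x inv) => //.
- by move=> l s' y k; rewrite !inE => /pred2P[]->.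
- move=> l u s' uadj _ s'1 s'3 [r5 m r4].
  have e_xu : e x u by rewrite -(mem_adj adjP).
  rewrite /= s'3 m m3; have [uw|uw] := eqVneq u w.
    have : 0 < #|nbrs e w :&: A|.
      by rewrite card_gt0; apply/set0Pn; exists x; rewrite !inE e_sym exw.
    by rewrite uw Aw; case: #|_| => //= k _; split.
  have -> : (u \in A) = false.
    by apply: contraNF uw => Au; apply/eqP/set1P; rewrite -Nx !inE e_xu.
  by split=> //; rewrite mem_rcons inE eq_sym (negPf uw).
move=> t s' le_t lds' s'1 [r5 m r4].
have s'4 : reg s' 4 = w by apply: r4; rewrite (mem_adj adjP).
have pl' : peeled A D s' by split=> // u; rewrite m.
have [pl2 s21 m2'] := run_remove s'1 s'4 pl' Ax Nx.
apply: runs_loop_free => // t' le_t'; apply: (fin _ _ _ _ w _ _ s21 _ pl2).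
- rewrite [X in _ <= X]/potential (big_setD1 x) //= -/(potential _) leq_add2r.
  by move: le_t le_t'; rewrite /=; clear; lia.
- exact: loaded_run.
- by have [rj _] := @run_spares [:: 5] [::] remove s' isT; rewrite rj.
move=> u uw [c3u|->]; last first.
  by case: pl2 => _ _ ->; rewrite !inE eqxx.
have [->|ux] := eqVneq u x; first by case: pl2 => _ _ ->; rewrite !inE eqxx.
by rewrite m2' // m.
Qed.

Lemma minimum_IDS_finder_correct : acyclic e ->
  runs_linear 500 (graph_size e) minimum_IDS_finder (input adj set0)
    (fun s => exists D : {set 'I_n}, output_set s D /\ minimum_IDS e D).
Proof.
move=> acyclic_e; rewrite /runs_linear.
suff [t [s' [E [le H]]]] : runs minimum_IDS_finder (input adj set0)
    (fun t s' => t <= 500 * (graph_size e).+1 /\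
       exists D : {set 'I_n}, output_set s' D /\ minimum_IDS e D) by exists t, s'.
apply: runs_seq.
pose inv1 (_ : unit) k s := prepared k s.
apply: (@runs_for_vertices _ adj unit inv1 (fun _ => 0) 100 _ tt)
  => [g k s x j|g v s lds s1 s5 J|||].
- by rewrite !inE => /pred2P[]->.
- apply: runs_seq; apply: (runs_survey (P := preferred e v) lds s1) => [s' w _ lds' s'1 s'3|].
    rewrite -[holds _ _]/(~~ (holds s' (leaf_test 1) && ~~ (reg s' 1 < reg s' 3))).
    by rewrite (holds_leaf_test lds' s'1) s'1 s'3 negb_and negbK.
  move=> t s' le_t lds' fr s'4 s'6 s'7 m3.
  have s'1 : reg s' 1 = v by rewrite -s1; case: fr => ->.
  apply: runs_loop_free => // t' le_t'; have [rj _] := @run_spares [:: 5] [::] force s' isT.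
  split.
  + exact: loaded_run.
  + by rewrite rj // -s5; case: fr => ->.
  + exists tt; first exact: prepared_step J fr s'1 s'4 s'6 s'7 m3.
    by rewrite !addn0; move: le_t le_t'; rewrite /=; clear; lia.
- exact: input_loaded.
- by split=> v //; rewrite cell_input_set in_set0.
move=> t1 s1 _ lds1 [m2 m3]; rewrite !add0n !addn0 => le1.
pose inv2 (g : {set 'I_n} * {set 'I_n}) k s :=
  peeled g.1 g.2 s /\ forall u : 'I_n, u < k -> cell s 3 u != 1.
apply: (@runs_for_vertices _ adj _ inv2 (fun g => potential g.1) 10 _ (setT, forced e)) => //.
- move=> [A D] v s lds sv s5 [pl c3].
  (* Among the vertices up to [v], only the current one may have exactly one remaining neighbour.
     The current vertex [x] may itself exceed [v]. *)
  pose J (g : {set 'I_n} * {set 'I_n}) s' := [/\ loaded adj s', reg s' 5 = v,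
    peeled g.1 g.2 s' & exists2 x : 'I_n, reg s' 1 = x &
      forall u : 'I_n, u < v.+1 -> u != x -> cell s' 3 u != 1].
  have J0 : J (A, D) s.
    split=> //; exists v => // u; rewrite ltnS leq_eqVlt => /predU1P[/val_inj->|/c3//].
    by rewrite eqxx.
  apply: runs_weaken (runs_while (pot := fun g => potential g.1) _ J0) _.
    move=> [A1 D1] s' [lds' s'5 pl1 [x s'1 c31]]; rewrite /= s'1 => /eqP c3x.
    apply: (runs_peel_step lds' s'1 pl1 c3x) => t s2 A2 D2 x2 le2 lds2 s21 s25 pl2 c32.
    exists (A2, D2); last by apply: leq_trans le2; rewrite /= leq_add2r leq_add2l.
    split=> //; first by rewrite s25.
    exists x2 => // u uv ux2; apply: c32 => //.
    by have [->|ux] := eqVneq u x; [right|left; apply: c31].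
  move=> t s' [[A' D'] [[lds' s'5 pl' [x s'1 c3']] /= stop le]]; split=> //.
  exists (A', D'); last by move: le; rewrite /=; clear; lia.
  split=> // u uv; have [->|] := eqVneq u x; last exact: c3'.
  by rewrite s'1 in stop.
- split=> //; split=> [|v|v]; first exact: greedy_cover_init.
    by rewrite m2 ltn_ord.
  by rewrite m3 ltn_ord in_setT setIT.
move=> t2 s2 [A D] lds2 [[gc c2 c3] /= not1] le2; split.
  (* Every vertex is removed at most once, so all removals together stay within this initial
     potential. *)
  have potT : potential setT = 60 * input_size adj.
    by rewrite /potential /input_size big_distrr; apply: eq_bigl => u; rewrite in_setT.
  rewrite potT in le2; have := input_size_le adjP; move: le1 le2; clear.
  by move: (potential A) => p; lia.
exists D; split=> //; apply: greedy_cover_minimum gc => // x Ax.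
by have := not1 x (ltn_ord x); rewrite c3 Ax.
Qed.

End Construction.

End Programs.

Theorem mainTheorem4 :
  (exists (p : cmd) (c : nat),
     forall (n : nat) (e : rel 'I_n) (adj : 'I_n -> seq 'I_n)
            (D : {set 'I_n}),
       simple_graph e -> acyclic e -> adjacency_lists e adj ->
       runs_linear c (graph_size e) p (input adj D)
         (fun s => output_bool s (IDS e D)))
  /\
  (exists (p : cmd) (c : nat),
     forall (n : nat) (e : rel 'I_n) (adj : 'I_n -> seq 'I_n),
       simple_graph e -> acyclic e -> adjacency_lists e adj ->
       runs_linear c (graph_size e) p (input adj set0)
         (fun s => exists D : {set 'I_n}, output_set s D /\ minimum_IDS e D)).

Proof.
split.
- exists IDS_decider, 500 => n e adj D simple_e acyclic_e adjP.
  exact: IDS_decider_correct.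
- exists minimum_IDS_finder, 500 => n e adj simple_e acyclic_e adjP.
  exact: minimum_IDS_finder_correct.
Qed.
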